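(* For every finite, simple, undirected, connected graph $G$, we have $\chi(G) \le 3^{\zeta(G)}$, where $\chi(G)$ is the chromatic number and $\zeta(G)$ is the localization number of $G$.
   Context: Localization game: let $G$ be a finite, simple, undirected, connected graph and $m$ a positive integer. One player controls $m$ cops, the other controls an invisible robber. The robber first chooses a starting vertex $r_1$. In round $t=1,2,\dots$, the cops choose vertices $u_1,\dots,u_m$ of $G$ (arbitrarily; they are not restricted to moving to neighboring vertices, and the choice may depend on all earlier probes and their results) and learn the distance vector $(d_G(u_1,r_t),\dots,d_G(u_m,r_t))$; then the robber either stays or moves to a neighbor, so $r_{t+1}=r_t$ or $r_{t+1}$ is adjacent to $r_t$. The cops capture the robber in round $t$ if, after the probe of round $t$, the robber's current vertex $r_t$ is uniquely determined by the information the cops have received, i.e. all robber trajectories $r'_1,\dots,r'_t$ (consecutive vertices equal or adjacent) consistent with all the distance vectors received so far satisfy $r'_t=r_t$. The cops have a winning strategy if they have a strategy that captures the robber after finitely many rounds against every possible robber trajectory (equivalently, even a robber who knows the cops' entire strategy in advance). The robber wins if he is never captured. The localization number $\zeta(G)$ is the least positive integer $m$ for which $m$ cops have a winning strategy on $G$. *)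

(* Defs.v *)
From mathcomp Require Import all_boot.
From mathcomp Require Import boolp.

Set Implicit Arguments.
Unset Strict Implicit.
Unset Printing Implicit Defensive.

Record connected_graph := ConnectedGraph {
  vertex :> finType;
  adj : rel vertex;
  adj_sym : symmetric adj;
  adj_irr : irreflexive adj;
  vertex_nonempty : 0 < #|vertex|;
  adj_connected : forall x y : vertex, connect adj x y }.

Definition walk (G : connected_graph) (x y : G) (n : nat) : bool :=
  [exists p : n.-tuple G, path (@adj G) x p && (last x p == y)].

Lemma ex_walk (G : connected_graph) (x y : G) : exists n, walk x y n.
Proof.
have /connectP[p xp ->] := adj_connected x y.
by exists (size p); apply/existsP; exists (in_tuple p); rewrite xp eqxx.
Qed.

Definition dist (G : connected_graph) (x y : G) : nat := ex_minn (ex_walk x y).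

Lemma dist0 (G : connected_graph) (x y : G) : (dist x y == 0) = (x == y).
Proof.
rewrite /dist; case: ex_minnP => n wn minn; apply/eqP/eqP => [n0|xy].
  by move: wn; rewrite n0 => /existsP[p]; rewrite tuple0 => /eqP.
apply/eqP; rewrite -leqn0; apply: minn; apply/existsP; exists [tuple].
exact/eqP.
Qed.

Definition proper_coloring (G : connected_graph) (k : nat)
    (c : {ffun G -> 'I_k}) : bool :=
  [forall x, forall y, adj x y ==> (c x != c y)].

Definition colorable (G : connected_graph) (k : nat) : bool :=
  [exists c : {ffun G -> 'I_k}, proper_coloring c].

Lemma ex_colorable (G : connected_graph) : exists k, colorable G k.
Proof.
exists #|G|; apply/existsP; exists [ffun x => enum_rank x].
apply/forallP => x; apply/forallP => y; apply/implyP => xy.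
rewrite !ffunE; apply/eqP => /enum_rank_inj exy.
by rewrite exy adj_irr in xy.
Qed.

Definition chromatic_number (G : connected_graph) : nat :=
  ex_minn (ex_colorable G).

(* Rounds are numbered from 0: [r t] is the robber's vertex when the probe of
   round [t] is made. *)

Section Game.
Variables (G : connected_graph) (m : nat).

Definition answer (u : m.-tuple G) (v : G) : m.-tuple nat :=
  [tuple dist (tnth u i) v | i < m].

Definition strategy := seq (m.-tuple G * m.-tuple nat) -> m.-tuple G.

Fixpoint history (sigma : strategy) (r : nat -> G) (t : nat) :
    seq (m.-tuple G * m.-tuple nat) :=
  if t is s.+1 then
    let h := history sigma r s in rcons h (sigma h, answer (sigma h) (r s))
  else [::].

Definition probe (sigma : strategy) (r : nat -> G) (t : nat) : m.-tuple G :=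
  sigma (history sigma r t).

Definition robber_step (x y : G) : Prop := y = x \/ adj x y.

Definition trajectory (r : nat -> G) : Prop :=
  forall s, robber_step (r s) (r s.+1).

(* Only the values of [r'] up to round [t] matter. *)
Definition trajectory_upto (t : nat) (r' : nat -> G) : Prop :=
  forall s, s < t -> robber_step (r' s) (r' s.+1).

Definition consistent (sigma : strategy) (r : nat -> G) (t : nat)
    (r' : nat -> G) : Prop :=
  forall s, s <= t ->
    answer (probe sigma r s) (r' s) = answer (probe sigma r s) (r s).

Definition captured (sigma : strategy) (r : nat -> G) (t : nat) : Prop :=
  forall r', trajectory_upto t r' -> consistent sigma r t r' -> r' t = r t.

Definition winning (sigma : strategy) : Prop :=
  forall r, trajectory r -> exists t, captured sigma r t.

Definition cops_win : Prop := exists sigma, winning sigma.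

End Game.

Lemma ex_cops_win (G : connected_graph) :
  exists m, (0 < m) && `[< cops_win G m >].
Proof.
exists #|G|; rewrite vertex_nonempty /=; apply/asboolP.
exists (fun=> [tuple enum_val i | i < #|G|]) => r _; exists 0 => r' _.
move=> /(_ 0 (leqnn 0)) /(congr1 (fun a => tnth a (enum_rank (r 0)))).
rewrite !tnth_mktuple enum_rankK => d0.
have /eqP d1 : dist (r 0) (r 0) == 0 by rewrite dist0.
by apply/esym/eqP; rewrite -dist0 d0 d1.
Qed.

Definition localization_number (G : connected_graph) : nat :=
  ex_minn (ex_cops_win G).

(* Main.v *)
Require Import Defs.
From mathcomp Require Import all_boot.
From mathcomp Require Import boolp zify.

Set Implicit Arguments.
Unset Strict Implicit.
Unset Printing Implicit Defensive.

(** The degeneracy of a graph controls both sides. Moving along an edge changes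
    the distance to a fixed vertex by at most one, so one probe by [m] cops
    splits the closed neighbourhood of any vertex into at most [3 ^ m] classes.
    Suppose that some nonempty set [S] of vertices induces a subgraph of minimum
    degree at least [3 ^ m]. Wherever the robber stands in [S], the part of
    his closed neighbourhood in [S] has more than [3 ^ m] vertices, so two of
    them give the same answer to the next probe (lemma [same_answer]). The
    robber, who can simulate the cops' strategy, moves to one of the two; the
    cops cannot exclude the other one. He stays in [S], repeats this for ever
    and is never captured (lemma [robber_evades]).

    Hence, if [m] cops win, then every nonempty set of vertices contains a
    vertex with fewer than [3 ^ m] neighbours in that set. Colouring such a
    vertex last, and the others by induction, gives a proper colouring with
    [3 ^ m] colours (lemma [greedy_coloring]). *)

Section Graph.
Variable G : connected_graph.
Implicit Types (S : {set G}) (u v x y : G).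

Lemma dist_adj u x y : adj x y -> dist u y <= (dist u x).+1.
Proof.
move=> xy; rewrite {1}/dist; case: ex_minnP => n _; apply.
rewrite /dist; case: ex_minnP => k /existsP[p /andP[up /eqP px]] _.
apply/existsP; exists [tuple of rcons p y].
by rewrite /= rcons_path up px xy last_rcons eqxx.
Qed.

Definition closed_nbhd S v : {set G} := [set x in S | (x == v) || adj v x].

Lemma card_closed_nbhd S v :
  v \in S -> #|closed_nbhd S v| = #|[set x in S | adj v x]|.+1.
Proof.
move=> vS; have -> : closed_nbhd S v = v |: [set x in S | adj v x].
  by apply/setP => x; rewrite !inE; case: eqVneq => // ->; rewrite vS.
by rewrite cardsU1 !inE adj_irr andbF.
Qed.

Lemma dist_closed_nbhd S u v x : x \in closed_nbhd S v ->
  dist u v <= (dist u x).+1 /\ dist u x <= (dist u v).+1.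
Proof.
rewrite inE => /andP[_ /orP[/eqP-> // | vx]].
by split; apply: dist_adj; rewrite // adj_sym.
Qed.

(** Relative to [v], the answer of each cop is one of the three values
    [-1], [0], [1]; this is the pigeonhole principle for the resulting
    map to [{ffun 'I_m -> 'I_3}]. *)
Lemma same_answer m S v (p : m.-tuple G) : 3 ^ m < #|closed_nbhd S v| ->
  exists x y, [/\ x \in closed_nbhd S v, y \in closed_nbhd S v,
    y != x & answer p y = answer p x].
Proof.
move=> big.
(* Adding one before subtracting keeps the difference nonnegative. *)
pose f x := [ffun i : 'I_m =>
  inord ((dist (tnth p i) x).+1 - dist (tnth p i) v) : 'I_3].
have /injectivePn : ~~ injectiveb (fun x : {x | x \in closed_nbhd S v} => f (val x)).
  apply/negP => /injectiveP finj.
  by have := leq_card _ finj; rewrite card_sig card_ffun !card_ord leqNgt big.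
case=> -[x xS] [[y yS]] /= xy fxy; exists x, y; split=> //.
  by apply: contraNneq xy => yx; apply/eqP/val_inj.
apply: eq_from_tnth => i; rewrite !tnth_mktuple.
move/ffunP/(_ i): fxy; rewrite !ffunE => /(congr1 val).
have [? ?] := dist_closed_nbhd (tnth p i) xS.
have [? ?] := dist_closed_nbhd (tnth p i) yS.
by rewrite /= !inordK; lia.
Qed.

Section Evasion.
Variables (m : nat) (sigma : strategy G m) (S : {set G}) (v0 : G).
Hypothesis v0S : v0 \in S.
Hypothesis S_dense : {in S, forall v, 3 ^ m < #|closed_nbhd S v|}.

Definition ambiguous (p : m.-tuple G) v x : bool :=
  (x \in closed_nbhd S v) &&
  [exists y in closed_nbhd S v, (y != x) && (answer p y == answer p x)].

Definition evading_move p v : G := odflt v [pick x | ambiguous p v x].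

Lemma evading_moveP p v : v \in S -> ambiguous p v (evading_move p v).
Proof.
move=> vS; rewrite /evading_move; case: pickP => //= none.
have [x [y [xS yS yx pyx]]] := same_answer p (S_dense vS).
have /negP[] := negbT (none x); rewrite /ambiguous xS /=.
by apply/existsP; exists y; rewrite yS yx pyx eqxx.
Qed.

(** The next move depends on the probe, hence on the whole history, which in
    turn depends on the earlier moves: the recursion carries the history along
    with the position. The position in [play t] is the one before the
    move that precedes the probe of round [t]; the vertex [v0] is a fictitious
    position from which the robber reaches his starting vertex. *)
Fixpoint play (t : nat) : seq (m.-tuple G * m.-tuple nat) * G :=
  if t is s.+1 then
    let: (h, v) := play s in
    let x := evading_move (sigma h) v in
    (rcons h (sigma h, answer (sigma h) x), x)
  else ([::], v0).

Definition evader (t : nat) : G := (play t.+1).2.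

Lemma evader_eq t : evader t = evading_move (sigma (play t).1) (play t).2.
Proof. by rewrite /evader /=; case: (play t). Qed.

Lemma history_evader t : history sigma evader t = (play t).1.
Proof. by elim: t => //= t ->; rewrite evader_eq; case: (play t). Qed.

Lemma play_in_S t : (play t).2 \in S.
Proof.
elim: t => //= t; case: (play t) => h v /= vS.
by have /andP[] := evading_moveP (sigma h) vS; rewrite inE => /andP[].
Qed.

Lemma evader_ambiguous t : ambiguous (probe sigma evader t) (play t).2 (evader t).
Proof. by rewrite /probe history_evader evader_eq evading_moveP ?play_in_S. Qed.

Lemma closed_nbhd_step v x : x \in closed_nbhd S v -> robber_step v x.
Proof. by rewrite inE => /andP[_ /orP[/eqP|]]; [left | right]. Qed.

Lemma trajectory_evader : trajectory evader.
Proof.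
move=> t; apply: closed_nbhd_step.
by have /andP[] := evader_ambiguous t.+1.
Qed.

Lemma evader_not_captured t : ~ captured sigma evader t.
Proof.
have /andP[_ /existsP[y /and3P[yS yx /eqP py]]] := evader_ambiguous t.
(* The decoy differs from the true trajectory only in the last round. *)
move=> /(_ (fun s => if s == t then y else evader s)) /=.
rewrite eqxx => capt; move/eqP: yx; apply; apply: capt => s.
  move=> st; rewrite ltn_eqF //; case: eqP => [ts|_].
    by apply: closed_nbhd_step; move: yS; rewrite -ts.
  exact: trajectory_evader.
by move=> _ /=; case: eqP => // ->.
Qed.

End Evasion.

Lemma robber_evades m S : S != set0 ->
  {in S, forall v, 3 ^ m <= #|[set x in S | adj v x]|} -> ~ cops_win G m.
Proof.
case/set0Pn => v0 v0S dense [sigma win].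
have S_dense : {in S, forall v, 3 ^ m < #|closed_nbhd S v|}.
  by move=> v vS; rewrite card_closed_nbhd // ltnS dense.
have [t] := win _ (trajectory_evader sigma v0S S_dense).
exact: evader_not_captured.
Qed.

Lemma greedy_coloring k S : 0 < k ->
  (forall T : {set G}, T != set0 ->
    exists2 v, v \in T & #|[set x in T | adj v x]| < k) ->
  exists c : {ffun G -> 'I_k}, {in S &, forall x y, adj x y -> c x != c y}.
Proof.
move=> k_gt0 degen; have [n] := ubnP #|S|.
elim: n S => // n IHn S leSn.
have [-> | /degen[v vS deg_v]] := eqVneq S set0.
  by exists [ffun=> Ordinal k_gt0] => x y; rewrite inE.
have [|c cP] := IHn (S :\ v); first by rewrite (cardsD1 v) vS in leSn.
pose used := c @: [set x in S | adj v x].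
have [a a_free] : exists a, a \notin used.
  apply/existsP; rewrite -negb_forall; apply/negP => /forallP all_used.
  have : k <= #|used| by rewrite -[k in k <= _]card_ord; apply/subset_leq_card/subsetP.
  by rewrite leqNgt (leq_ltn_trans (leq_imset_card _ _) deg_v).
have a_ok x : x \in S -> adj v x -> c x != a.
  by move=> xS vx; apply: contraNneq a_free => <-; apply: imset_f; rewrite inE xS.
exists [ffun x => if x == v then a else c x] => x y xS yS xy; rewrite !ffunE.
case: (eqVneq x v) (eqVneq y v) => [xv | xv] [yv | yv].
- by rewrite xv yv adj_irr in xy.
- by rewrite eq_sym a_ok // -xv.
- by rewrite a_ok // -yv adj_sym.
- by apply: cP => //; rewrite !inE ?xv ?yv.
Qed.

Lemma cops_win_colorable m : cops_win G m -> colorable G (3 ^ m).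
Proof.
move=> win; have [T T_neq0 | c cP] := @greedy_coloring (3 ^ m) setT (expn_gt0 3 m).
  have [/exists_inP // | dense] :=
    boolP [exists v in T, #|[set x in T | adj v x]| < 3 ^ m].
  case: (robber_evades (m := m) T_neq0 _ win) => v vT; rewrite leqNgt.
  by move: dense; rewrite negb_exists_in => /forall_inP; apply.
apply/existsP; exists c; apply/forallP => x; apply/forallP => y.
by apply/implyP; apply: cP; rewrite inE.
Qed.

End Graph.

Theorem corollary2p2 (G : connected_graph) :
  chromatic_number G <= 3 ^ localization_number G.
Proof.
rewrite /chromatic_number /localization_number.
case: ex_minnP => k _ k_min; case: ex_minnP => m /andP[_ /asboolP win] _.
exact/k_min/cops_win_colorable.
Qed.
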